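(* Let $\mathcal C$ be a $K$-linear Grothendieck category. Let $A=\bigoplus_{n\in\mathbb Z}A_n$ be an $A_\infty$-algebra over $K$ and let $(\mathbb F,\theta_{\mathbb F})$ be a non-unital monad on $\mathcal C$. Suppose that $\mathbb F$ preserves direct sums. Then the collection of functors $$\mathbb U^{A,\mathbb F}_{\mathcal C}=\{\mathbb U^{A,\mathbb F}_{\mathcal C,n}:=A_n\otimes\mathbb F(-):\mathcal C\to\mathcal C\}_{n\in\mathbb Z}$$ is an $A_\infty$-monad on $\mathcal C$. In particular, the collection of functors $\mathbb U^A_{\mathcal C}=\{\mathbb U^A_{\mathcal C,n}:=A_n\otimes(-):\mathcal C\to\mathcal C\}_{n\in\mathbb Z}$ is an $A_\infty$-monad on $\mathcal C$.
   Context: $K$ is a field. For a $K$-vector space $V$, $V\otimes(-):\mathcal C\to\mathcal C$ is the tensor (copower) functor, left adjoint to $\underline{Hom}(V,-):\mathcal C\to\mathcal C$. A non-unital monad $(\mathbb F,\theta_{\mathbb F})$ is an endofunctor $\mathbb F$ with an associative natural transformation $\theta_{\mathbb F}:\mathbb F\circ\mathbb F\to\mathbb F$ (no unit required). An $A_\infty$-algebra over $K$ is a graded space $A=\bigoplus_{n\in\mathbb Z}A_n$ with graded $K$-linear maps $m_k:A^{\otimes k}\to A$ of degree $2-k$ ($k\ge1$) such that for each $n\ge1$, $\sum_{p+q+r=n,\,p,r\ge0,\,q\ge1}(-1)^{p+qr}m_{p+1+r}(1^{\otimes p}\otimes m_q\otimes1^{\otimes r})=0$ (Koszul signs when applied to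 elements). For $\bar n=(n_1,\dots,n_k)\in\mathbb Z^k$: $|\bar n|=k$, $\Sigma\bar n=n_1+\dots+n_k$, $\mathbb U_{\bar n}=\mathbb U_{n_1}\circ\dots\circ\mathbb U_{n_k}$. An $A_\infty$-monad $(\mathbb U,\Theta)$: endofunctors $\{\mathbb U_n\}_{n\in\mathbb Z}$ with natural transformations $\theta_k(\bar n):\mathbb U_{\bar n}\to\mathbb U_{\Sigma\bar n+(2-k)}$ ($k\ge1$, $\bar n\in\mathbb Z^k$) such that for each $\bar z\in\mathbb Z^N$, $N\ge1$, $0=\sum(-1)^{p+qr+q\Sigma\bar n}\theta_{p+1+r}(\bar n,\Sigma\bar n'+(2-q),\bar n'')(\mathbb U_{\bar n}\ast\theta_q(\bar n')\ast\mathbb U_{\bar n''})$ over partitions $\bar z=(\bar n,\bar n',\bar n'')$, $|\bar n|=p$, $|\bar n'|=q\geq 1$, $|\bar n''|=r$ ($\ast$ is horizontal composition). The $A_\infty$-monad structure meant on $\mathbb U^{A,\mathbb F}_{\mathcal C}$ is the one whose maps $\theta_k(\bar n):A_{n_1}\otimes\dots\otimes A_{n_k}\otimes\mathbb F^k(-)\to A_{\Sigma\bar n+(2-k)}\otimes\mathbb F(-)$ are induced by the component $A_{n_1}\otimes\dots\otimes A_{n_k}\to A_{\Sigma\bar n+(2-k)}$ of $m_k$ and the iterated multiplication $\mathbb F^k\to\mathbb F$. *)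

(* Defs.v *)
From HB Require Import structures.
From mathcomp Require Import all_boot all_order all_algebra.
From mathcomp Require Import boolp.
From mathcomp Require Import zify.

Set Implicit Arguments.
Unset Strict Implicit.
Unset Printing Implicit Defensive.
Import GRing.Theory.
Local Open Scope ring_scope.
#[local] Obligation Tactic := idtac.

(** * K-linear categories *)

Record linCat (K : fieldType) := LinCat {
  obj :> Type;
  hom : obj -> obj -> lmodType K;
  idm : forall X, hom X X;
  comp : forall X Y Z, hom Y Z -> hom X Y -> hom X Z;
  compA : forall W X Y Z (h : hom Y Z) (g : hom X Y) (f : hom W X),
    comp h (comp g f) = comp (comp h g) f;
  comp1m : forall X Y (f : hom X Y), comp (idm Y) f = f;
  compm1 : forall X Y (f : hom X Y), comp f (idm X) = f;
  comp_linearr : forall X Y Z (g : hom Y Z),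
    linear (fun f : hom X Y => comp g f);
  comp_linearl : forall X Y Z (f : hom X Y),
    linear (fun g : hom Y Z => comp g f) }.

Arguments idm {K l} X.
Arguments comp {K l X Y Z} g f.

Declare Scope lincat_scope.
Notation "g ∘ f" := (comp g f) (at level 40, left associativity) : lincat_scope.
Local Open Scope lincat_scope.

(* Composition of functors is only associative up to a propositional equality
   of objects; [eqm] is the corresponding identity morphism. *)
Definition eqm (K : fieldType) (C : linCat K) (X Y : C) (e : X = Y) : hom X Y :=
  match e with erefl => idm X end.

Section CompLinear.
Variables (K : fieldType) (C : linCat K) (X Y Z : C).

Lemma comp0m (f : hom X Y) : (0 : hom Y Z) ∘ f = 0.
Proof.
by have := comp_linearl f (-1) (0 : hom Y Z) 0; rewrite !scaleN1r addr0 oppr0 addNr.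
Qed.

Lemma compm0 (g : hom Y Z) : g ∘ (0 : hom X Y) = 0.
Proof.
by have := comp_linearr g (-1) (0 : hom X Y) 0; rewrite !scaleN1r addr0 oppr0 addNr.
Qed.

Lemma compDr (g : hom Y Z) (f f' : hom X Y) : g ∘ (f + f') = g ∘ f + g ∘ f'.
Proof. by rewrite -[f]scale1r comp_linearr !scale1r. Qed.

Lemma compZr a (g : hom Y Z) (f : hom X Y) : g ∘ (a *: f) = a *: (g ∘ f).
Proof. by rewrite -[a *: f]addr0 comp_linearr compm0 addr0. Qed.

Lemma compBr (g : hom Y Z) (f f' : hom X Y) : g ∘ (f - f') = g ∘ f - g ∘ f'.
Proof. by rewrite compDr -scaleN1r compZr scaleN1r. Qed.
End CompLinear.

(** * Grothendieck categories *)

Section Grothendieck.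
Variables (K : fieldType) (C : linCat K).

Definition mono (X Y : C) (f : hom X Y) :=
  forall T (g h : hom T X), f ∘ g = f ∘ h -> g = h.
Definition epi (X Y : C) (f : hom X Y) :=
  forall T (g h : hom Y T), g ∘ f = h ∘ f -> g = h.

Definition is_kernel (X Y Z : C) (k : hom X Y) (f : hom Y Z) :=
  f ∘ k = 0 /\
  forall T (h : hom T Y), f ∘ h = 0 -> exists! h' : hom T X, k ∘ h' = h.
Definition is_cokernel (X Y Z : C) (c : hom Y Z) (f : hom X Y) :=
  c ∘ f = 0 /\
  forall T (h : hom Y T), h ∘ f = 0 -> exists! h' : hom Z T, h' ∘ c = h.

Definition short_exact (X Y Z : C) (f : hom X Y) (g : hom Y Z) :=
  is_kernel f g /\ is_cokernel g f.

Definition is_zero (Z : C) :=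
  forall X : C, (forall f : hom X Z, f = 0) /\ (forall f : hom Z X, f = 0).

Definition is_biproduct (X Y P : C) (i1 : hom X P) (i2 : hom Y P)
    (p1 : hom P X) (p2 : hom P Y) :=
  [/\ p1 ∘ i1 = idm X, p2 ∘ i2 = idm Y, p1 ∘ i2 = 0, p2 ∘ i1 = 0
    & i1 ∘ p1 + i2 ∘ p2 = idm P].

Record abelian : Prop := Abelian {
  ab_zero : exists Z : C, is_zero Z;
  ab_biproduct : forall X Y : C, exists (P : C) (i1 : hom X P) (i2 : hom Y P)
    (p1 : hom P X) (p2 : hom P Y), is_biproduct i1 i2 p1 p2;
  ab_kernel : forall (X Y : C) (f : hom X Y),
    exists (Z : C) (k : hom Z X), is_kernel k f;
  ab_cokernel : forall (X Y : C) (f : hom X Y),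
    exists (Z : C) (c : hom Y Z), is_cokernel c f;
  ab_mono : forall (X Y : C) (f : hom X Y), mono f ->
    exists (Z : C) (g : hom Y Z), is_kernel f g;
  ab_epi : forall (X Y : C) (f : hom X Y), epi f ->
    exists (Z : C) (g : hom Z X), is_cokernel f g }.

Definition is_coproduct (I : Type) (X : I -> C) (S : C)
    (inj : forall i, hom (X i) S) :=
  forall (T : C) (f : forall i, hom (X i) T),
    exists! h : hom S T, forall i, h ∘ inj i = f i.

(* "Small" refers to the universe of I, which may be below that of [obj]. *)
Definition has_coproducts := forall (I : Type) (X : I -> C),
  exists (S : C) (inj : forall i, hom (X i) S), is_coproduct inj.

Record smallCat := SmallCat {
  sobj :> Type;
  shom : sobj -> sobj -> Type;
  sid : forall i, shom i i;
  scomp : forall i j k, shom j k -> shom i j -> shom i k;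
  scompA : forall i j k l (h : shom k l) (g : shom j k) (f : shom i j),
    scomp h (scomp g f) = scomp (scomp h g) f;
  scomp1m : forall i j (f : shom i j), scomp (sid j) f = f;
  scompm1 : forall i j (f : shom i j), scomp f (sid i) = f }.

Definition filtered (J : smallCat) :=
  [/\ inhabited J,
      forall i j : J, exists k, inhabited (shom i k) /\ inhabited (shom j k)
    & forall (i j : J) (f g : shom i j),
        exists k (h : shom j k), scomp h f = scomp h g].

Record diagram (J : smallCat) := Diagram {
  dobj :> J -> C;
  dmor : forall i j, shom i j -> hom (dobj i) (dobj j);
  dmor1 : forall i, dmor (sid i) = idm (dobj i);
  dmorM : forall i j k (g : shom j k) (f : shom i j),
    dmor (scomp g f) = dmor g ∘ dmor f }.

Definition diagram_nat (J : smallCat) (D E : diagram J)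
    (a : forall i, hom (D i) (E i)) :=
  forall i j (f : shom i j), a j ∘ dmor D f = dmor E f ∘ a i.

Definition is_cocone (J : smallCat) (D : diagram J) (L : C)
    (c : forall i, hom (D i) L) :=
  forall i j (f : shom i j), c j ∘ dmor D f = c i.

Definition is_colimit (J : smallCat) (D : diagram J) (L : C)
    (c : forall i, hom (D i) L) :=
  is_cocone c /\
  forall (T : C) (t : forall i, hom (D i) T), is_cocone t ->
    exists! h : hom L T, forall i, h ∘ c i = t i.

Definition filtered_colimits_exact :=
  forall (J : smallCat), filtered J ->
  forall (D1 D2 D3 : diagram J)
    (a : forall i, hom (D1 i) (D2 i)) (b : forall i, hom (D2 i) (D3 i)),
    diagram_nat a -> diagram_nat b ->
    (forall i, short_exact (a i) (b i)) ->
  forall (L1 L2 L3 : C) (c1 : forall i, hom (D1 i) L1)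
    (c2 : forall i, hom (D2 i) L2) (c3 : forall i, hom (D3 i) L3),
    is_colimit c1 -> is_colimit c2 -> is_colimit c3 ->
  forall (la : hom L1 L2) (lb : hom L2 L3),
    (forall i, la ∘ c1 i = c2 i ∘ a i) ->
    (forall i, lb ∘ c2 i = c3 i ∘ b i) ->
    short_exact la lb.

Definition is_generator (G : C) :=
  forall (X Y : C) (f g : hom X Y),
    (forall h : hom G X, f ∘ h = g ∘ h) -> f = g.

Record grothendieck : Prop := Grothendieck {
  gro_abelian : abelian;
  gro_coproducts : has_coproducts;
  gro_exact : filtered_colimits_exact;
  gro_generator : exists G : C, is_generator G }.

End Grothendieck.

(** * Functors and natural transformations *)

(* Functors between K-linear categories are K-linear. *)
Record functor (K : fieldType) (C D : linCat K) := Functor {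
  fobj :> C -> D;
  fmor : forall X Y : C, hom X Y -> hom (fobj X) (fobj Y);
  fmor1 : forall X, fmor (idm X) = idm (fobj X);
  fmorM : forall X Y Z (g : hom Y Z) (f : hom X Y),
    fmor (g ∘ f) = fmor g ∘ fmor f;
  fmor_linear : forall X Y, linear (@fmor X Y) }.
Arguments fmor {K C D} F {X Y} f : rename.

Record nattrans (K : fieldType) (C D : linCat K) (F G : functor C D) := NatTrans {
  nt :> forall X, hom (F X) (G X);
  nt_natural : forall X Y (f : hom X Y), nt Y ∘ fmor F f = fmor G f ∘ nt X }.

Section Functors.
Variables (K : fieldType).

Program Definition fid (C : linCat K) : functor C C :=
  @Functor K C C (fun X => X) (fun X Y f => f) _ _ _.
Next Obligation. by []. Qed.
Next Obligation. by []. Qed.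
Next Obligation. by []. Qed.

Program Definition fcomp (C D E : linCat K) (G : functor D E) (F : functor C D) :
    functor C E :=
  @Functor K C E (fun X => G (F X)) (fun X Y f => fmor G (fmor F f)) _ _ _.
Next Obligation. by move=> *; rewrite /= !fmor1. Qed.
Next Obligation. by move=> *; rewrite /= !fmorM. Qed.
Next Obligation. by move=> * ? ? ?; rewrite /= !fmor_linear. Qed.

Definition preserves_direct_sums (C D : linCat K) (F : functor C D) :=
  forall (I : Type) (X : I -> C) (S : C) (inj : forall i, hom (X i) S),
    is_coproduct inj -> is_coproduct (fun i => fmor F (inj i)).

Fixpoint ucomp (C : linCat K) (U : int -> functor C C) (ns : seq int) :
    functor C C :=
  if ns is n :: ns' then fcomp (U n) (ucomp U ns') else fid C.

Lemma ucomp_cat (C : linCat K) (U : int -> functor C C) ns ms X :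
  ucomp U (ns ++ ms) X = ucomp U ns (ucomp U ms X).
Proof. by elim: ns => //= n ns ->. Qed.

End Functors.

(** * Tensor functors [V ⊗ -] *)

Section Copowers.
Variables (K : fieldType) (C : linCat K).

(* [tin V X v : X -> V ⊗ X] is "v ⊗ -"; it exhibits
   hom (V ⊗ X) Y as the linear maps V -> hom X Y. *)
Record copowers := Copowers {
  tobj : lmodType K -> C -> C;
  tin : forall (V : lmodType K) (X : C), V -> hom X (tobj V X);
  tin_linear : forall (V : lmodType K) (X : C), linear (@tin V X);
  tlift : forall (V : lmodType K) (X Y : C) (g : V -> hom X Y),
    linear g -> hom (tobj V X) Y;
  tliftE : forall (V : lmodType K) (X Y : C) (g : V -> hom X Y) (lg : linear g) v,
    tlift lg ∘ tin X v = g v;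
  tlift_uniq : forall (V : lmodType K) (X Y : C) (f g : hom (tobj V X) Y),
    (forall v, f ∘ tin X v = g ∘ tin X v) -> f = g }.

Lemma tin_comp_linear (T : copowers) (V : lmodType K) (X Y : C) (f : hom X Y) :
  linear (fun v : V => tin T Y v ∘ f).
Proof. by move=> a u v; rewrite tin_linear comp_linearl. Qed.

Program Definition tens (T : copowers) (V : lmodType K) : functor C C :=
  @Functor K C C (tobj T V) (fun X Y f => tlift T (tin_comp_linear T f)) _ _ _.
Next Obligation.
by move=> T V X; apply: tlift_uniq => v; rewrite /= tliftE comp1m compm1.
Qed.
Next Obligation.
move=> T V X Y Z g f; apply: tlift_uniq => v.
by rewrite -compA !tliftE !compA tliftE.
Qed.
Next Obligation.
move=> T V X Y a f g; apply: tlift_uniq => v.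
by rewrite comp_linearl !tliftE comp_linearr.
Qed.

(* The functors Hom(V,-), right adjoint to [V ⊗ -] (see [tens_adjoint]). *)
Record powers := Powers {
  pobj : lmodType K -> C -> C;
  pev : forall (V : lmodType K) (Y : C), V -> hom (pobj V Y) Y;
  pev_linear : forall (V : lmodType K) (Y : C), linear (@pev V Y);
  plift : forall (V : lmodType K) (X Y : C) (g : V -> hom X Y),
    linear g -> hom X (pobj V Y);
  pliftE : forall (V : lmodType K) (X Y : C) (g : V -> hom X Y) (lg : linear g) v,
    pev Y v ∘ plift lg = g v;
  plift_uniq : forall (V : lmodType K) (X Y : C) (f g : hom X (pobj V Y)),
    (forall v, pev Y v ∘ f = pev Y v ∘ g) -> f = g }.

Lemma pev_comp_linear (P : powers) (V : lmodType K) (X Y : C) (f : hom X Y) :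
  linear (fun v : V => f ∘ pev P X v).
Proof. by move=> a u v; rewrite pev_linear comp_linearr. Qed.

Program Definition homf (P : powers) (V : lmodType K) : functor C C :=
  @Functor K C C (pobj P V) (fun X Y f => plift P (pev_comp_linear P f)) _ _ _.
Next Obligation.
by move=> P V X; apply: plift_uniq => v; rewrite /= pliftE comp1m compm1.
Qed.
Next Obligation.
move=> P V X Y Z g f; apply: plift_uniq => v.
by rewrite compA !pliftE -!compA pliftE.
Qed.
Next Obligation.
move=> P V X Y a f g; apply: plift_uniq => v.
by rewrite comp_linearr !pliftE comp_linearl.
Qed.

Definition adjoint (L R : functor C C) :=
  exists (phi : forall X Y, hom (L X) Y -> hom X (R Y)),
    [/\ forall X Y, bijective (phi X Y), forall X Y, linear (phi X Y)
      & forall X X' Y Y' (f : hom X' X) (h : hom (L X) Y) (g : hom Y Y'),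
          phi X' Y' (g ∘ h ∘ fmor L f) = fmor R g ∘ phi X Y h ∘ f].

Lemma tens_adjoint (T : copowers) (P : powers) V :
  adjoint (tens T V) (homf P V).
Proof.
have lphi X Y (h : hom (tens T V X) Y) : linear (fun v => h ∘ tin T X v).
  by move=> a u v; rewrite tin_linear comp_linearr.
have lpsi X Y (h : hom X (homf P V Y)) : linear (fun v => pev P Y v ∘ h).
  by move=> a u v; rewrite pev_linear comp_linearl.
exists (fun X Y h => plift P (lphi X Y h)); split.
- move=> X Y; exists (fun h => tlift T (lpsi X Y h)) => h.
    by apply: tlift_uniq => v; rewrite tliftE pliftE.
  by apply: plift_uniq => v; rewrite pliftE tliftE.
- move=> X Y a f g; apply: plift_uniq => v.
  by rewrite comp_linearr !pliftE comp_linearl.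
move=> X X' Y Y' f h g; apply: plift_uniq => v.
by rewrite pliftE !compA pliftE -!compA tliftE (compA _ _ f) pliftE !compA.
Qed.

(* Copowers are not an additional structure on a Grothendieck category. *)
Lemma grothendieck_copowers : grothendieck C -> inhabited copowers.
Proof.
move=> [[_ _ _ hcok _ _] hcop _ _].
pose good (V : lmodType K) X (Q : {Q : C & V -> hom X Q}) :=
  linear (projT2 Q) /\ forall Y (g : V -> hom X Y), linear g ->
    exists! h : hom (projT1 Q) Y, forall v, h ∘ projT2 Q v = g v.
have ex (V : lmodType K) X : exists Q, good V X Q.
  have [S [i iP]] := hcop V (fun _ => X).
  have [R [j jP]] := hcop (K * V * V)%type (fun _ => X).
  have [r [rE _]] := jP S
    (fun t => i (t.1.1 *: t.1.2 + t.2) - (t.1.1 *: i t.1.2 + i t.2)).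
  have [Q [c [cr cP]]] := hcok _ _ r.
  have lc D (d : hom S D) : d ∘ r = 0 -> linear (fun v => d ∘ i v).
    move=> dr a u v; apply/eqP; rewrite -subr_eq0; apply/eqP.
    have := congr1 (fun f => f ∘ j (a, u, v)) dr.
    by rewrite -compA rE /= comp0m compBr compDr compZr.
  exists (existT _ Q (fun v => c ∘ i v)); split => [|Y g lg]; first exact: lc.
  have [h [hE hU]] := iP Y g.
  have hr : h ∘ r = 0.
    have [z [_ zU]] := jP Y (fun=> 0).
    have z0 : z = 0 by apply: zU => t; rewrite comp0m.
    rewrite -z0; apply/esym/zU => t.
    by rewrite -compA rE compBr compDr compZr !hE lg subrr.
  have [k [kE kU]] := cP _ _ hr.
  exists k; split => [v|k' k'E]; first by rewrite /= compA kE hE.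
  by apply: kU; apply/esym/hU => v; rewrite -compA k'E.
pose Q V X := projT1 (cid (ex V X)).
have QP V X : good V X (Q V X) := projT2 (cid (ex V X)).
pose l V X Y g lg := cid ((QP V X).2 Y g lg).
constructor; unshelve econstructor.
- by move=> V X; exact: projT1 (Q V X).
- by move=> V X; exact: projT2 (Q V X).
- by move=> V X Y g lg; exact: projT1 (l V X Y g lg).
- by move=> V X; exact: (QP V X).1.
- by move=> V X Y g lg v; exact: (projT2 (l V X Y g lg)).1.
move=> V X Y f g fg.
have lg : linear (fun v => g ∘ projT2 (Q V X) v).
  by move=> a u v; rewrite (QP V X).1 comp_linearr.
have [h [_ hU]] := (QP V X).2 Y _ lg.
by rewrite -(hU f) // -(hU g).
Qed.

End Copowers.

(** * Degrees *)

Definition Sigma (ns : seq int) : int := \sum_(n <- ns) n.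

(* The degree of m_k and theta_k on inputs of degrees n_1, ..., n_k. *)
Definition odeg (ns : seq int) : int := Sigma ns + (2 - (size ns)%:Z).

Section Partitions.
(* The partition z = (n, n', n'') with |n| = p and |n'| = q. *)
Variables (z : seq int) (p q : nat).
Definition zpre := take p z.
Definition zmid := take q (drop p z).
Definition zpost := drop (p + q) z.
(* The degrees left once the middle block is replaced by the output on it. *)
Definition zout := zpre ++ odeg zmid :: zpost.

Lemma zcat : z = zpre ++ zmid ++ zpost.
Proof. by rewrite /zpre /zmid /zpost addnC -drop_drop !cat_take_drop. Qed.

Lemma zout_gt0 : (0 < size zout)%N.
Proof. by rewrite size_cat addnS. Qed.

Lemma zmid_gt0 : (p < size z)%N -> (0 < q)%N -> (0 < size zmid)%N.
Proof. by move=> ? ?; rewrite size_take size_drop; case: (ltnP q); lia. Qed.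

Lemma odeg_zout : (p + q <= size z)%N ->
  odeg zout = Sigma z + (3 - (size z)%:Z).
Proof.
move=> pq; have -> : Sigma z = Sigma zpre + Sigma zmid + Sigma zpost.
  by rewrite {1}zcat /Sigma !big_cat /= addrA.
have s1 : size zpre = p by rewrite size_takel //; lia.
have s2 : size zmid = q by rewrite size_takel // size_drop; lia.
have s3 : size zpost = (size z - (p + q))%N by rewrite size_drop.
rewrite {1}/odeg /zout /Sigma big_cat big_cons /= size_cat /= s1 s3 /odeg s2.
rewrite -![\sum_(_ <- _) _]/(Sigma _); move: (Sigma zpre) (Sigma zmid) (Sigma zpost) => x y t.
by lia.
Qed.
End Partitions.

Lemma sum_index_ok (N : nat) (p : 'I_N) (q : 'I_(N - p)) : (p + q.+1 <= N)%N.
Proof. by have := ltn_ord p; have := ltn_ord q; lia. Qed.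

Definition zmid_pos (z : seq int) (p : 'I_(size z)) (q : 'I_(size z - p)) :
    (0 < size (zmid z p q.+1))%N :=
  zmid_gt0 (ltn_ord p) (ltn0Sn q).

(** * A-infinity algebras *)

(* [args A [:: n_1; ...; n_k]] is A n_1 x ... x A n_k x unit. *)
Fixpoint args (K : fieldType) (A : int -> lmodType K) (ns : seq int) : Type :=
  if ns is n :: ns' then (A n * args A ns')%type else unit.

Fixpoint cat_args (K : fieldType) (A : int -> lmodType K) ns ms :
    args A ns -> args A ms -> args A (ns ++ ms) :=
  match ns return args A ns -> args A ms -> args A (ns ++ ms) with
  | [::] => fun _ b => b
  | n :: ns' => fun a b => (a.1, cat_args a.2 b)
  end.

Fixpoint take_args (K : fieldType) (A : int -> lmodType K) p ns {struct ns} :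
    args A ns -> args A (take p ns) :=
  match ns, p return args A ns -> args A (take p ns) with
  | n :: ns', p'.+1 => fun a => (a.1, take_args p' a.2)
  | _, _ => fun _ => tt
  end.

Fixpoint drop_args (K : fieldType) (A : int -> lmodType K) p ns {struct ns} :
    args A ns -> args A (drop p ns) :=
  match ns, p return args A ns -> args A (drop p ns) with
  | n :: ns', p'.+1 => fun a => drop_args p' a.2
  | [::], _ => fun a => a
  | n :: ns', 0%N => fun a => a
  end.

Definition castd (K : fieldType) (A : int -> lmodType K) (d d' : int)
    (e : d = d') (x : A d) : A d' := eq_rect d (fun i => A i) x d' e.

(* The graded map m_k : A^{⊗k} -> A of degree 2-k is given by its components
   A_{n_1} x ... x A_{n_k} -> A_{n_1+...+n_k+(2-k)}, linear in each variable. *)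
Record ainf_algebra (K : fieldType) := AinfAlgebra {
  acar :> int -> lmodType K;
  am : forall ns : seq int, (0 < size ns)%N -> args acar ns -> acar (odeg ns);
  am_linear : forall ns n ms (h : (0 < size (ns ++ n :: ms))%N)
    (a : args acar ns) (b : args acar ms),
    linear (fun x : acar n => am h (cat_args a ((x, b) : args acar (n :: ms))));
  (* q.+1 is the q of the usual formula; the last summand of the exponent is
     the Koszul sign of moving m_q, of degree 2-q, past the first p inputs. *)
  am_rel : forall (z : seq int), (0 < size z)%N -> forall a : args acar z,
    \sum_(p < size z) \sum_(q < size z - p)
      (-1 : K) ^ (p%:Z + q.+1%:Z * (size z - (p + q.+1))%N%:Z
                  + (2 - q.+1%:Z) * Sigma (zpre z p)) *:
      castd (A := acar) (odeg_zout (sum_index_ok q))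
        (am (zout_gt0 z p q.+1)
           (cat_args (take_args p a)
              ((am (zmid_pos q) (take_args q.+1 (drop_args p a)),
                drop_args (p + q.+1) a)
               : args acar (odeg (zmid z p q.+1) :: zpost z p q.+1)))) = 0 }.

(** * A-infinity monads *)

Section AinfMonad.
Variables (K : fieldType) (C : linCat K) (U : int -> functor C C).

(* theta_k(n_1, ..., n_k), for k >= 1. *)
Definition thetas := forall ns : seq int, (0 < size ns)%N ->
  nattrans (ucomp U ns) (U (odeg ns)).

Lemma ucomp_split (z : seq int) p q X : ucomp U z X =
  ucomp U (zpre z p) (ucomp U (zmid z p q) (ucomp U (zpost z p q) X)).
Proof. by rewrite {1}(zcat z p q) !ucomp_cat. Qed.

Lemma ucomp_zout (z : seq int) p q X :
  ucomp U (zpre z p) (U (odeg (zmid z p q)) (ucomp U (zpost z p q) X)) =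
  ucomp U (zout z p q) X.
Proof. by rewrite ucomp_cat. Qed.

(* The component at X of theta(n, S n' + (2-q), n'') (U_n * theta(n') * U_n''). *)
Definition ainf_term (Th : thetas) (z : seq int) (p : 'I_(size z))
    (q : 'I_(size z - p)) (X : C) :
    hom (ucomp U z X) (U (Sigma z + (3 - (size z)%:Z)) X) :=
  eqm (congr1 (fun d => U d X) (odeg_zout (sum_index_ok q)))
  ∘ Th _ (zout_gt0 z p q.+1) X
  ∘ eqm (ucomp_zout z p q.+1 X)
  ∘ fmor (ucomp U (zpre z p)) (Th _ (zmid_pos q) (ucomp U (zpost z p q.+1) X))
  ∘ eqm (ucomp_split z p q.+1 X).

Definition is_ainf_monad (Th : thetas) :=
  forall (z : seq int), (0 < size z)%N -> forall X : C,
    \sum_(p < size z) \sum_(q < size z - p)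
      (-1 : K) ^ (p%:Z + q.+1%:Z * (size z - (p + q.+1))%N%:Z
                  + q.+1%:Z * Sigma (zpre z p)) *: ainf_term Th q X = 0.

End AinfMonad.

(** * Non-unital monads *)

Record numonad (K : fieldType) (C : linCat K) := NuMonad {
  mfun :> functor C C;
  mmul : nattrans (fcomp mfun mfun) mfun;
  mmulA : forall X,
    mmul X ∘ fmor mfun (mmul X) = mmul X ∘ mmul (mfun X) }.

Section UAF.
Variables (K : fieldType) (C : linCat K) (T : copowers C) (A : ainf_algebra K).

Fixpoint fiter (F : functor C C) (k : nat) : functor C C :=
  if k is k'.+1 then fcomp F (fiter F k') else fid C.

(* The iterated multiplication F^k -> F; only k >= 1 is meaningful, the value
   at k = 0 being junk since F has no unit. *)
Fixpoint itmul (F : numonad C) (k : nat) (X : C) : hom (fiter F k X) (F X) :=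
  match k return hom (fiter F k X) (F X) with
  | 0%N => 0
  | k'.+1 =>
    match k' return hom (fiter F k' X) (F X) -> hom (fiter F k'.+1 X) (F X) with
    | 0%N => fun _ => idm (F X)
    | k''.+1 => fun mu => mmul F X ∘ fmor F mu
    end (itmul F k' X)
  end.

Definition UAF (F : functor C C) (n : int) : functor C C :=
  fcomp (tens T (A n)) F.

Definition UA (n : int) : functor C C := tens T (A n).

(* For a_i in A_{n_i}, "a_1 ⊗ ... ⊗ a_k ⊗ -" : F^k X -> U_{n_1} ... U_{n_k} X,
   under the identification of the target, A_{n_1}⊗F(... A_{n_k}⊗F(X)), with
   A_{n_1}⊗...⊗A_{n_k}⊗F^k(X).  These maps run through v ⊗ - for the pure
   tensors v, so morphisms out of A_{n_1}⊗...⊗A_{n_k}⊗F^k(X) are determined by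
   their composites with them. *)
Fixpoint UAF_pure (F : functor C C) (ns : seq int) (X : C) :
    args (acar A) ns -> hom (fiter F (size ns) X) (ucomp (UAF F) ns X) :=
  match ns return args (acar A) ns -> hom (fiter F (size ns) X) (ucomp (UAF F) ns X) with
  | [::] => fun _ => idm X
  | n :: ns' => fun a => tin T _ a.1 ∘ fmor F (UAF_pure F X a.2)
  end.

Fixpoint UA_pure (ns : seq int) (X : C) : args (acar A) ns -> hom X (ucomp UA ns X) :=
  match ns return args (acar A) ns -> hom X (ucomp UA ns X) with
  | [::] => fun _ => idm X
  | n :: ns' => fun a => tin T _ a.1 ∘ UA_pure X a.2
  end.

(* theta(a_1 ⊗ ... ⊗ a_k ⊗ -) = m_k(a_1, ..., a_k) ⊗ mu^k, i.e. theta_k(n) is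
   induced by m_k and the iterated multiplication. *)
Definition UAF_induced (F : numonad C) (Th : thetas (UAF F)) :=
  forall ns (h : (0 < size ns)%N) (X : C) (a : args (acar A) ns),
    Th ns h X ∘ UAF_pure F X a = tin T (F X) (am h a) ∘ itmul F (size ns) X.

Definition UA_induced (Th : thetas UA) :=
  forall ns (h : (0 < size ns)%N) (X : C) (a : args (acar A) ns),
    Th ns h X ∘ UA_pure X a = tin T X (am h a).

End UAF.

(* Main.v *)
(** A K-vector space has a basis B, so V ⊗ X is the direct sum of copies of X
    indexed by B.  A functor G preserving direct sums therefore carries the
    universal property of V ⊗ X to G(V ⊗ X): morphisms out of it are the linear
    families V -> hom (G X) Y.  Iterating this over F, F^2, ... shows that
    morphisms out of U_{n_1} ... U_{n_k} X are the multilinear families of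
    morphisms out of F^k X, so that theta_k exists, is natural and is unique,
    and every identity between such morphisms can be tested on pure tensors.
    On these, each summand of the A-infinity relation becomes
    m(a_1, ..., m(...), ..., a_N) ⊗ mu^N by associativity of the multiplication
    of F, with the sign of the corresponding summand for A because
    (-1)^((2-q) s) = (-1)^(q s). *)
From HB Require Import structures.
From mathcomp Require Import all_boot all_order all_algebra.
From mathcomp Require Import boolp classical_sets zify.
Require Import Defs.

Set Implicit Arguments.
Unset Strict Implicit.
Unset Printing Implicit Defensive.
Import GRing.Theory.
Local Open Scope ring_scope.
Local Open Scope lincat_scope.

(** * Bases *)

Section LinearMaps.
Variables (K : fieldType) (V W : lmodType K) (f : V -> W).
Hypothesis lf : linear f.

Lemma linear_0 : f 0 = 0.
Proof. by have := lf (-1) 0 0; rewrite !scaleN1r addr0 oppr0 addNr. Qed.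

Lemma linear_D x y : f (x + y) = f x + f y.
Proof. by rewrite -[x]scale1r lf !scale1r. Qed.

Lemma linear_Z a x : f (a *: x) = a *: f x.
Proof. by rewrite -[a *: x]addr0 lf linear_0 addr0. Qed.

Lemma linear_big (I : Type) (r : seq I) (g : I -> V) :
  f (\sum_(i <- r) g i) = \sum_(i <- r) f (g i).
Proof. exact: (big_morph f linear_D linear_0). Qed.
End LinearMaps.

Section Bases.
Variable K : fieldType.

Definition comb (V : eqType) (W : lmodType K) (f : V -> W) (s : seq (K * V)) :=
  \sum_(x <- s) x.1 *: f x.2.

Lemma comb_cat (V : eqType) (W : lmodType K) (f : V -> W) s t :
  comb f (s ++ t) = comb f s + comb f t.
Proof. exact: big_cat. Qed.

Definition scale_comb (V : eqType) (a : K) (s : seq (K * V)) :=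
  [seq (a * x.1, x.2) | x <- s].

Lemma comb_scale (V : eqType) (W : lmodType K) (f : V -> W) a s :
  comb f (scale_comb a s) = a *: comb f s.
Proof.
rewrite /comb big_map scaler_sumr; apply: eq_bigr => x _.
by rewrite scalerA.
Qed.

Variable V : lmodType K.

Definition supported (B : set V) (s : seq (K * V)) :=
  forall x, x \in s -> B x.2.

Lemma supported_cat B s t : supported B s -> supported B t -> supported B (s ++ t).
Proof. by move=> hs ht x; rewrite mem_cat => /orP[/hs|/ht]. Qed.

Lemma supported_scale B a s : supported B s -> supported B (scale_comb a s).
Proof. by move=> hs x /mapP[y /hs By ->]. Qed.

(* Coefficients of repeated vectors are not collected, hence linear
   independence reads: a vanishing combination vanishes for formal reasons. *)
Definition lin_free (B : set V) := forall s, supported B s -> comb id s = 0 ->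
  forall (W : lmodType K) (f : V -> W), comb f s = 0.

Definition spanning (B : set V) :=
  forall v, exists2 s, supported B s & v = comb id s.

Lemma lin_free_chain (F : set (set V)) :
  (F `<=` lin_free)%classic -> total_on F subset ->
  lin_free (\bigcup_(X in F) X)%classic.
Proof.
move=> Ff Ft s hs s0 W f.
have [-> | [X FX hX]] : s = [::] \/ exists2 X, F X & supported X s.
- elim: s hs {s0} => [|x s IH] hs; [by left | right].
  have [Y FY Yx] := hs x (mem_head _ _).
  have [y ys|->|[X FX hX]] := IH; first by apply: hs; rewrite inE ys orbT.
    by exists Y => // y; rewrite inE => /eqP->.
  case: (Ft _ _ FX FY) => sub.
    by exists Y => // y; rewrite inE => /predU1P[-> //|/hX /sub].
  by exists X => // y; rewrite inE => /predU1P[->|/hX //]; exact: sub.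
- by rewrite /comb big_nil.
exact: (Ff X FX s hX).
Qed.

(** A maximal free set spans: a vector outside its span could be adjoined. *)
Lemma exists_basis : exists B : set V, lin_free B /\ spanning B.
Proof.
have [B [fB maxB]] := Zorn_bigcup lin_free_chain.
exists B; split => // v; apply: contrapT => nv.
have nBv : ~ B v.
  move=> Bv; apply: nv; exists [:: (1, v)].
    by move=> x; rewrite inE => /eqP->.
  by rewrite /comb big_seq1 scale1r.
apply: (maxB (fun x => x = v \/ B x)).
  by split=> [x Bx|sub]; [right | apply: nBv; apply: sub; left].
move=> s hs s0 W f.
(* The occurrences of [v] are collected into one coefficient [k]; if [k] were nonzero, solving for
   [v] would put it in the span of [B]. *)
pose t := [seq x <- s | x.2 != v]; pose k := \sum_(x <- s | x.2 == v) x.1.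
have combE (W' : lmodType K) (g : V -> W') : comb g s = k *: g v + comb g t.
  rewrite /comb (bigID (fun x => x.2 == v)) /= big_filter scaler_suml.
  by congr (_ + _); apply: eq_bigr => x /eqP->.
have ht : supported B t.
  by move=> x; rewrite mem_filter => /andP[/eqP nx /hs[]].
have k0 : k = 0.
  apply: contrapT => /eqP kn; apply: nv.
  exists (scale_comb (- k^-1) t); first exact: supported_scale.
  move/eqP: s0; rewrite comb_scale combE addr_eq0 => /eqP e.
  by rewrite scaleNr -scalerN -e scalerA mulVf ?scale1r.
rewrite combE k0 scale0r add0r; apply: fB => //.
by rewrite -s0 combE k0 scale0r add0r.
Qed.

(** Each vector is written as a combination chosen once and for all; freeness, applied to the
    difference of two combinations of equal value, makes the result independent of the choice. *)
Lemma lin_free_extend B (W : lmodType K) (f : V -> W) :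
  lin_free B -> spanning B ->
  exists2 g : V -> W, linear g & forall b, B b -> g b = f b.
Proof.
move=> fB sB.
have [c cP] := choice (fun v =>
  let: ex_intro2 s hs e := sB v in
  ex_intro (fun s => supported B s /\ v = comb id s) s (conj hs e)).
have combE s t : supported B s -> supported B t -> comb id s = comb id t ->
    comb f s = comb f t.
  move=> hs ht e; apply/eqP; rewrite -subr_eq0 -scaleN1r -comb_scale -comb_cat.
  apply/eqP/fB; first by apply: supported_cat => //; exact: supported_scale.
  by rewrite comb_cat comb_scale e scaleN1r subrr.
exists (fun v => comb f (c v)) => [a u v|b Bb].
  rewrite -comb_scale -comb_cat; apply: combE.
  - exact: (cP _).1.
  - by apply: supported_cat (cP v).1; apply: supported_scale (cP u).1.
  by rewrite comb_cat comb_scale -!(cP _).2.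
have -> : f b = comb f [:: (1, b)] by rewrite /comb big_seq1 scale1r.
apply: combE; first exact: (cP _).1.
  by move=> x; rewrite inE => /eqP->.
by rewrite -(cP b).2 /comb big_seq1 scale1r.
Qed.

Lemma spanning_eq B (W : lmodType K) (f g : V -> W) : spanning B ->
  linear f -> linear g -> (forall b, B b -> f b = g b) -> f =1 g.
Proof.
move=> sB lf lg e v; have [s hs ->] := sB v.
rewrite /comb (linear_big lf) (linear_big lg); apply: eq_big_seq => x /hs Bx.
by rewrite (linear_Z lf) (linear_Z lg) e.
Qed.

End Bases.

(** * Copowers under functors preserving direct sums *)

Section Copowers.
Variables (K : fieldType) (C : linCat K) (T : copowers C).

(* For a basis B of V, the object V ⊗ X is the coproduct of copies of X indexed
   by B, and G preserves that coproduct. *)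
Lemma preserves_copower (D : linCat K) (G : functor C D) (V : lmodType K) X
    (Y : D) (g : V -> hom (G X) Y) :
  preserves_direct_sums G -> linear g ->
  exists! h : hom (G (tobj T V X)) Y, forall v, h ∘ fmor G (tin T X v) = g v.
Proof.
move=> hG lg; have [B [fB sB]] := exists_basis V.
pose inB (b : {b | B b}) := tin T X (sval b).
have cop : is_coproduct inB.
  move=> Z f.
  (* The value 0 off [B] is a filler: only the values on [B] are extended linearly. *)
  pose f' b := if pselect (B b) is left Bb then f (exist _ b Bb) else 0.
  have [k lk kE] := lin_free_extend f' fB sB.
  exists (tlift T lk); split=> [[b Bb]|h hE].
    rewrite /inB /= tliftE kE // /f'; case: pselect => // Bb'.
    by rewrite (Prop_irrelevance Bb' Bb).
  apply: tlift_uniq; apply: (spanning_eq sB).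
  - by move=> a u v; rewrite tin_linear comp_linearr.
  - by move=> a u v; rewrite tin_linear comp_linearr.
  move=> b Bb; rewrite tliftE kE // /f'; case: pselect => // Bb'.
  by rewrite -hE.
have lcomp (h : hom (G (tobj T V X)) Y) :
    linear (fun v => h ∘ fmor G (tin T X v)).
  by move=> a u v; rewrite tin_linear fmor_linear comp_linearr.
have [h [hE hU]] := hG _ _ _ _ cop Y (fun b => g (sval b)).
exists h; split=> [|h' h'E]; last by apply: hU => b; exact: h'E.
apply: (spanning_eq sB) => // b Bb; exact: (hE (exist _ b Bb)).
Qed.

End Copowers.

(** * Morphisms up to equality of source and target *)

Section Heq.
Variables (K : fieldType).

(** Relating morphisms with different endpoints lets the transports [eqm] be dropped and recovered
    only at the end. *)
Inductive heq (C : linCat K) (X Y : C) (f : hom X Y) :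
    forall X' Y' : C, hom X' Y' -> Prop :=
  Heq : heq f f.

Variable C : linCat K.

Lemma heq_sym (X Y X' Y' : C) (f : hom X Y) (f' : hom X' Y') :
  heq f f' -> heq f' f.
Proof. by case; exact: Heq. Qed.

Lemma heq_trans (X Y X' Y' X'' Y'' : C) (f : hom X Y) (f' : hom X' Y')
  (f'' : hom X'' Y'') : heq f f' -> heq f' f'' -> heq f f''.
Proof. by move=> e; case. Qed.

(** Proof irrelevance makes every self-equality of an object trivial. *)
Lemma eqm_erefl (X : C) (e : X = X) : eqm e = idm X.
Proof. by rewrite (Prop_irrelevance e erefl). Qed.

Lemma heqE (X Y X' Y' : C) (f : hom X Y) (f' : hom X' Y') :
  heq f f' -> exists (eX : X' = X) (eY : Y = Y'), f' = eqm eY ∘ f ∘ eqm eX.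
Proof. by case; exists erefl, erefl; rewrite /= comp1m compm1. Qed.

Lemma heq_eq (X Y : C) (f f' : hom X Y) : heq f f' -> f = f'.
Proof. by move=> /heqE[eX [eY ->]]; rewrite !eqm_erefl comp1m compm1. Qed.

Lemma eq_heq (X Y : C) (f f' : hom X Y) : f = f' -> heq f f'.
Proof. by move->; exact: Heq. Qed.

Lemma heq_comp (X Y Z X' Y' Z' : C) (g : hom Y Z) (f : hom X Y)
    (g' : hom Y' Z') (f' : hom X' Y') :
  heq g g' -> heq f f' -> heq (g ∘ f) (g' ∘ f').
Proof.
move=> /heqE[eY [eZ {g'}->]] /heqE[eX [eY' {f'}->]].
case: Z' / eZ; case: Y' / eY' eY => eY; case: X / eX f => f.
rewrite (eqm_erefl eY) /= !comp1m !compm1; exact: Heq.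
Qed.

Lemma heq_eqml (X Y Y' : C) (e : Y = Y') (f : hom X Y) : heq (eqm e ∘ f) f.
Proof. by case: Y' / e; rewrite comp1m; exact: Heq. Qed.

Lemma heq_fmor (D : linCat K) (G : functor C D) (X Y X' Y' : C)
    (f : hom X Y) (f' : hom X' Y') :
  heq f f' -> heq (fmor G f) (fmor G f').
Proof. by case; exact: Heq. Qed.

Lemma heq_family (I : Type) (P Q : I -> C) (f : forall i, hom (P i) (Q i)) i j :
  i = j -> heq (f i) (f j).
Proof. by case: j /; exact: Heq. Qed.

End Heq.

(** * Heterogeneous argument lists *)

Section Args.
Variables (K : fieldType) (A : int -> lmodType K).

(** Bundling the degrees turns equality across the types [args A ns] into plain equality. *)
Definition tot ns (a : args A ns) : {ns & args A ns} := existT _ ns a.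

Lemma tot_cons n ns ms (x : A n) (a : args A ns) (b : args A ms) :
  tot a = tot b -> @tot (n :: ns) (x, a) = @tot (n :: ms) (x, b).
Proof.
by move=> e; apply: (congr1 (fun t => @tot (n :: projT1 t) (x, projT2 t)) e).
Qed.

Lemma cat_take_drop_args p ns (a : args A ns) :
  tot (cat_args (take_args p a) (drop_args p a)) = tot a.
Proof.
elim: ns p a => [|n ns IH] [|p] //= [x a].
by apply: tot_cons; apply: IH.
Qed.

Lemma drop_drop_args p q ns (a : args A ns) :
  tot (drop_args q (drop_args p a)) = tot (drop_args (p + q) a).
Proof. by elim: ns p a => [|n ns IH] [|p] //= a; case: q {IH} => //. Qed.

Lemma tot_cat ns ns' ms ms' (a : args A ns) (a' : args A ns') (b : args A ms)
    (b' : args A ms') :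
  tot a = tot a' -> tot b = tot b' -> tot (cat_args a b) = tot (cat_args a' b').
Proof.
move=> ea eb; rewrite -[tot _]/(tot (cat_args (projT2 (tot a)) (projT2 (tot b)))).
by rewrite ea eb.
Qed.

Lemma cat_args_split p q ns (a : args A ns) :
  tot (cat_args (take_args p a)
        (cat_args (take_args q (drop_args p a)) (drop_args (p + q) a))) = tot a.
Proof.
rewrite -(cat_take_drop_args p a); apply: tot_cat => //.
rewrite -(cat_take_drop_args q (drop_args p a)); apply: tot_cat => //.
by rewrite drop_drop_args.
Qed.

Variable W : lmodType K.

Fixpoint multilinear ns : (args A ns -> W) -> Prop :=
  match ns return (args A ns -> W) -> Prop with
  | [::] => fun _ => True
  | n :: ns' => fun g => (forall b, linear (fun x : A n => g (x, b))) /\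
                         (forall x, multilinear (fun b => g (x, b)))
  end.

(** Passes from linearity at each position, the form of [am_linear], to the recursive form suited to
    currying. *)
Lemma multilinear_splits ns (g : args A ns -> W) :
  (forall ps n ms (e : ps ++ n :: ms = ns) (a : args A ps) (b : args A ms),
     linear (fun x : A n =>
       g (eq_rect _ (args A) (cat_args a ((x, b) : args A (n :: ms))) _ e))) ->
  multilinear g.
Proof.
elim: ns g => //= n ns IH g hg; split=> [b|x].
  exact: (hg [::] n ns erefl tt b).
apply: IH => ps m ms e a b; case: ns / e g hg => g hg.
exact: (hg (n :: ps) m ms erefl (x, a) b).
Qed.

End Args.

Lemma multilinear_comp (K : fieldType) (A : int -> lmodType K) (V W : lmodType K)
    (f : V -> W) ns (g : args A ns -> V) :
  linear f -> multilinear g -> multilinear (fun a => f (g a)).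
Proof.
move=> lf; elim: ns g => //= n ns IH g [lg hg]; split=> [b a u v|x].
  by rewrite lg lf.
exact: IH.
Qed.

Lemma am_multilinear (K : fieldType) (A : ainf_algebra K) ns (h : (0 < size ns)%N) :
  multilinear (am (a0 := A) h).
Proof.
by apply: multilinear_splits => ps n ms e; case: ns / e h => h; apply: am_linear.
Qed.

(** * Iterated multiplications *)

Lemma nattrans_eq (K : fieldType) (C D : linCat K) (F G : functor C D)
    (a b : nattrans F G) : (forall X, a X = b X) -> a = b.
Proof.
case: a b => [a na] [b nb] /= e.
have {}e : a = b by apply: functional_extensionality_dep.
by case: b / e nb => nb; rewrite (Prop_irrelevance na nb).
Qed.

Section IteratedMultiplication.
Variables (K : fieldType) (C : linCat K).

Lemma fcomp_preserves_direct_sums (D E : linCat K) (G : functor D E)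
    (F : functor C D) :
  preserves_direct_sums G -> preserves_direct_sums F ->
  preserves_direct_sums (fcomp G F).
Proof. by move=> hG hF I X S inj /hF /hG. Qed.

Variable F : numonad C.

Lemma itmulS k X : (0 < k)%N ->
  itmul F k.+1 X = mmul F X ∘ fmor F (itmul F k X).
Proof. by case: k. Qed.

Lemma itmul_natural k X Y (f : hom X Y) :
  itmul F k Y ∘ fmor (fiter F k) f = fmor F f ∘ itmul F k X.
Proof.
(* At k = 0 the junk value 0 makes both sides vanish. *)
elim: k => [|k IH]; first by rewrite comp0m compm0.
case: k IH => [|k] IH; first by rewrite /= comp1m compm1.
rewrite itmulS // -compA /= -fmorM.
by rewrite -[fmor F (fmor _ f)]/(fmor (fiter F k.+1) f) IH
  fmorM !compA (nt_natural (mmul F)).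
Qed.

(** [itmul] multiplies the innermost copies first; associativity and naturality of [mmul] allow the
    outer [q.+1] copies to be collapsed before the others. *)
Lemma itmul_addl q r X :
  heq (itmul F (q.+1 + r) X) (itmul F r.+1 X ∘ itmul F q.+1 (fiter F r X)).
Proof.
case: r => [|r].
  rewrite addn0 /=; apply: heq_sym; rewrite comp1m; exact: Heq.
elim: q => [|q IH].
  rewrite [itmul F 1 _]/= compm1; exact: Heq.
rewrite addSn addSn itmulS //.
apply: heq_trans (heq_comp (Heq _) (heq_fmor F IH)) _; apply: eq_heq.
rewrite itmulS // !fmorM !compA mmulA; congr (_ ∘ _).
by rewrite -!compA; congr (_ ∘ _); exact: (nt_natural (mmul F)).
Qed.

Lemma fiter_add j k X : fiter F (j + k) X = fiter F j (fiter F k X).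
Proof. by elim: j => //= j ->. Qed.

Lemma fmor_eqm (D : linCat K) (G : functor C D) (X Y : C) (e : X = Y)
    (e' : G X = G Y) : fmor G (eqm e) = eqm e'.
Proof. by case: Y / e e' => e'; rewrite (eqm_erefl e') fmor1. Qed.

(** Peeling off the [p] outer copies of F reduces to [itmul_addl]. *)
Lemma itmul_middle p q r X
    (e : fiter F p (fiter F r.+1 X) = fiter F (p + r.+1) X) :
  heq (itmul F (p + r.+1) X ∘ eqm e ∘
         fmor (fiter F p) (itmul F q.+1 (fiter F r X)))
      (itmul F (p + (q.+1 + r)) X).
Proof.
elim: p e => [|p IH] e.
  by rewrite eqm_erefl compm1; apply/heq_sym/itmul_addl.
have e' := esym (fiter_add p r.+1 X).
rewrite [itmul F (p.+1 + r.+1) X](@itmulS (p + r.+1)) ?addnS //.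
rewrite [itmul F (p.+1 + _) X](@itmulS (p + (q.+1 + r))) ?addnS //.
rewrite -(fmor_eqm e' e) -!compA.
apply: heq_comp (Heq _) _; rewrite /= -!fmorM; apply: heq_fmor.
by rewrite compA; apply: IH.
Qed.

End IteratedMultiplication.

Lemma signzD2 (K : fieldType) (m k : int) : (-1 : K) ^ (m + 2 * k) = (-1) ^ m.
Proof.
rewrite expfzDr ?oppr_eq0 ?oner_eq0 // -exprz_exp.
by rewrite (_ : (-1) ^ 2 = 1) ?exp1rz ?mulr1 // -[LHS]/((-1) ^+ 2) sqrrN expr1n.
Qed.

(** * Endofunctors universal for linear families *)

(* [U n X] is characterised as A_n ⊗ F X, with [t n X a] in the role of "a ⊗ -",
   without fixing its construction: both [UAF T A F] and, for F the identity
   monad, [UA T A] are instances. *)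
Section Induced.
Variables (K : fieldType) (C : linCat K) (A : ainf_algebra K) (F : numonad C).
Variables (U : int -> functor C C).
Variable t : forall n X, acar A n -> hom (F X) (U n X).
Hypothesis t_linear : forall n X, linear (@t n X).
Hypothesis t_natural : forall n X Y (f : hom X Y) a,
  fmor (U n) f ∘ t X a = t Y a ∘ fmor F f.
Hypothesis F_sums : preserves_direct_sums F.
Hypothesis t_universal : forall G : functor C C, preserves_direct_sums G ->
  forall n X Y (g : acar A n -> hom (G (F X)) Y), linear g ->
  exists! h : hom (G (U n X)) Y, forall a, h ∘ fmor G (t X a) = g a.

Fixpoint pure ns X : args (acar A) ns -> hom (fiter F (size ns) X) (ucomp U ns X) :=
  match ns return args (acar A) ns -> hom (fiter F (size ns) X) (ucomp U ns X) with
  | [::] => fun _ => idm X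
  | n :: ns' => fun a => t _ a.1 ∘ fmor F (pure X a.2)
  end.

Lemma t_jointly_epi (G : functor C C) n X Y (f g : hom (G (U n X)) Y) :
  preserves_direct_sums G ->
  (forall a, f ∘ fmor G (t X a) = g ∘ fmor G (t X a)) -> f = g.
Proof.
move=> hG e.
have lg : linear (fun a => g ∘ fmor G (t X a)).
  by move=> k a b; rewrite t_linear fmor_linear comp_linearr.
have [h [_ hU]] := t_universal hG lg.
by rewrite -(hU f) // -(hU g).
Qed.

(** The functor [G] is kept general because the induction replaces it by G F. *)
Lemma pure_jointly_epi ns (G : functor C C) X Y (f g : hom (G (ucomp U ns X)) Y) :
  preserves_direct_sums G ->
  (forall a, f ∘ fmor G (pure X a) = g ∘ fmor G (pure X a)) -> f = g.
Proof.
elim: ns G f g => [|n ns IH] G f g hG e.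
  by have := e tt; rewrite /= fmor1 !compm1.
apply: t_jointly_epi => // v; apply: (IH (fcomp G F)) => [|a].
  exact: fcomp_preserves_direct_sums.
by have := e (v, a); rewrite /= fmorM !compA.
Qed.

(** Currying: for each first argument the induction hypothesis gives a morphism, linear in that
    argument by joint epimorphy, and [t_universal] glues these morphisms. *)
Lemma pure_universal ns (G : functor C C) X Y
    (g : args (acar A) ns -> hom (G (fiter F (size ns) X)) Y) :
  preserves_direct_sums G -> multilinear g ->
  exists h : hom (G (ucomp U ns X)) Y, forall a, h ∘ fmor G (pure X a) = g a.
Proof.
elim: ns G g => [|n ns IH] G g hG.
  by move=> _; exists (g tt) => -[]; rewrite /= fmor1 compm1.
move=> [lg mg]; have hGF := fcomp_preserves_direct_sums hG F_sums.
have [k kE] := choice (fun v => IH (fcomp G F) _ hGF (mg v)).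
have lk : linear k.
  move=> c u v; apply: (pure_jointly_epi hGF) => a.
  by rewrite comp_linearl !kE lg.
have [h [hE _]] := t_universal hG lk.
by exists h => -[v a]; rewrite /= fmorM compA hE kE.
Qed.

Lemma fid_preserves_direct_sums : preserves_direct_sums (fid C).
Proof. by []. Qed.

Lemma pure_eq ns X Y (f g : hom (ucomp U ns X) Y) :
  (forall a, f ∘ pure X a = g ∘ pure X a) -> f = g.
Proof. exact: (pure_jointly_epi fid_preserves_direct_sums). Qed.

Lemma pure_natural ns X Y (f : hom X Y) (a : args (acar A) ns) :
  fmor (ucomp U ns) f ∘ pure X a = pure Y a ∘ fmor (fiter F (size ns)) f.
Proof.
elim: ns a => [|n ns IH] a /=; first by rewrite comp1m compm1.
by rewrite compA t_natural -!compA -!fmorM IH.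
Qed.

Definition induced (Th : thetas U) :=
  forall ns (h : (0 < size ns)%N) (X : C) (a : args (acar A) ns),
    Th ns h X ∘ pure X a = t X (am h a) ∘ itmul F (size ns) X.

Lemma exists_induced : exists Th, induced Th.
Proof.
have ex ns (h : (0 < size ns)%N) X : exists th : hom (ucomp U ns X) (U (odeg ns) X),
    forall a, th ∘ pure X a = t X (am h a) ∘ itmul F (size ns) X.
  apply: (pure_universal fid_preserves_direct_sums).
  apply: (multilinear_comp (f := fun v => t X v ∘ itmul F (size ns) X)).
    by move=> k u v; rewrite t_linear comp_linearl.
  exact: am_multilinear.
have nat ns h X Y (f : hom X Y) :
    sval (cid (ex ns h Y)) ∘ fmor (ucomp U ns) f =
    fmor (U (odeg ns)) f ∘ sval (cid (ex ns h X)).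
  apply: pure_eq => a; case: cid => /= thY hY; case: cid => /= thX hX.
  by rewrite -!compA pure_natural hX !compA hY t_natural -!compA itmul_natural.
by exists (fun ns h => NatTrans (nat ns h)) => ns h X a /=; case: cid => /=.
Qed.

Lemma induced_unique Th Th' : induced Th -> induced Th' -> Th = Th'.
Proof.
move=> iTh iTh'; apply: functional_extensionality_dep => ns.
apply: functional_extensionality_dep => h; apply: nattrans_eq => X.
by apply: pure_eq => a; rewrite iTh iTh'.
Qed.

Lemma heq_pure_tot X ns ms (a : args (acar A) ns) (b : args (acar A) ms) :
  tot a = tot b -> heq (pure X a) (pure X b).
Proof.
move=> e; apply: (heq_family (fun s => pure X (projT2 s)) e).
Qed.

Lemma heq_pure_cat ns ms X (a : args (acar A) ns) (b : args (acar A) ms) :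
  heq (pure X (cat_args a b))
      (pure (ucomp U ms X) a ∘ fmor (fiter F (size ns)) (pure X b)).
Proof.
elim: ns a => [|n ns IH] a; first by rewrite /= comp1m; exact: Heq.
rewrite /= -compA -fmorM; apply: heq_comp; last exact: heq_fmor.
exact: (heq_family (fun Y => t (n := n) Y a.1) (ucomp_cat U ns ms X)).
Qed.

(** * The A-infinity relation on pure tensors *)

Section Relation.
Variable Th : thetas U.
Hypothesis iTh : induced Th.

(** Naturality slides the inner theta past [a] onto [b], where it becomes m on [b] tensored with a
    multiplication; the outer theta then evaluates, and [itmul_middle] merges the two
    multiplications. *)
Lemma theta_theta_pure x y w z X (a : args (acar A) x) (b : args (acar A) y)
    (c : args (acar A) w) (s : args (acar A) z)
    (h1 : (0 < size y)%N) (h2 : (0 < size (x ++ odeg y :: w))%N)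
    e1 (e2 : ucomp U z X = _) :
  tot s = tot (cat_args a (cat_args b c)) ->
  heq (Th h2 X ∘ eqm e1 ∘ fmor (ucomp U x) (Th h1 (ucomp U w X))
         ∘ eqm e2 ∘ pure X s)
      (t X (am h2 (cat_args a ((am h1 b, c) : args (acar A) (odeg y :: w))))
         ∘ itmul F (size z) X).
Proof.
move=> es; have ez : z = x ++ y ++ w := congr1 (@projT1 _ _) es.
have split_s : heq (eqm e2 ∘ pure X s)
    (pure _ a ∘ fmor (fiter F (size x))
       (pure (ucomp U w X) b ∘ fmor (fiter F (size y)) (pure X c))).
  apply: heq_trans (heq_eqml _ _) (heq_trans (heq_pure_tot X es) _).
  apply: heq_trans (heq_pure_cat _ _ _) _.
  apply: heq_comp (heq_family (fun Y => pure Y a) (ucomp_cat U y w X)) _.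
  exact/heq_fmor/heq_pure_cat.
rewrite -!compA.
apply: heq_trans (heq_comp (Heq _) (heq_comp (Heq _) (heq_comp (Heq _) split_s))) _.
rewrite [fmor _ _ ∘ (_ ∘ _)]compA pure_natural -[pure _ a ∘ _ ∘ _]compA -fmorM.
rewrite [Th h1 _ ∘ (_ ∘ _)]compA iTh -[_ ∘ fmor (fiter F (size y)) _]compA.
rewrite itmul_natural (compA (t _ _)) (fmorM (fiter F (size x))) (compA (pure _ a)).
(* The inner output followed by [c] is again a pure tensor, so the outer theta meets a
   concatenation. *)
pose c' : args (acar A) (odeg y :: w) := (am h1 b, c).
rewrite -[t _ _ ∘ _]/(pure X c').
have [eX [eY ->]] := heqE (heq_pure_cat X a c').
rewrite !compA -(compA (Th h2 X)) (_ : eqm e1 ∘ eqm eY = idm _); last first.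
  by case: _ / eY e1 => e1; rewrite (eqm_erefl e1) comp1m.
rewrite compm1 iTh -!compA; apply: heq_comp (Heq _) _; rewrite compA.
(* The length is generalized to [m], so that it can be replaced by a sum although the type of [e]
   depends on it. *)
have key m : m = (size x + (size w).+1)%N -> forall e,
    heq (itmul F m X ∘ eqm e ∘
         fmor (fiter F (size x)) (itmul F (size y) (fiter F (size w) X)))
        (itmul F (size z) X).
  move=> -> e; rewrite ez !size_cat.
  by case: (size y) {c'} h1 => // q _; apply: itmul_middle.
by apply: key; rewrite size_cat.
Qed.

Lemma tcast d d' (e : d = d') X (v : acar A d) :
  t X (castd e v) = eqm (congr1 (fun i => U i X) e) ∘ t X v.
Proof. by case: d' / e; rewrite comp1m. Qed.

Lemma induced_ainf_monad : is_ainf_monad Th.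
Proof.
move=> z hz X; apply: pure_eq => a.
have lpure Y : linear (fun f : hom (ucomp U z X) Y => f ∘ pure X a).
  exact: comp_linearl.
have ltm : linear (fun v => @t (Sigma z + (3 - (size z)%:Z)) X v ∘ itmul F (size z) X).
  by move=> k u v; rewrite t_linear comp_linearl.
(* The zero on the right is the image of the relation of A under the linear map [ltm]; the sums are
   then compared termwise. *)
rewrite comp0m -[RHS](linear_0 ltm) -(am_rel hz a) (linear_big ltm)
  (linear_big (lpure _)).
apply: eq_bigr => p _; rewrite (linear_big (lpure _)) (linear_big ltm).
apply: eq_bigr => q _; rewrite (linear_Z (lpure _)) (linear_Z ltm).
congr (_ *: _).
  (* The two exponents differ by twice [(q.+1 - 1) * Sigma (zpre z p)]. *)
  rewrite -[RHS](signzD2 _ _ ((q.+1%:Z - 1) * Sigma (zpre z p))).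
  by congr (_ ^ _); lia.
rewrite tcast /ainf_term -!compA.
congr (_ ∘ _); rewrite !compA; apply/heq_eq/theta_theta_pure.
exact/esym/cat_args_split.
Qed.

End Relation.
End Induced.

(** * The case of tensoring with A after F *)

Section UAF.
Variables (K : fieldType) (C : linCat K) (T : copowers C) (A : ainf_algebra K).
Variable F : numonad C.

Definition tin_UAF n (X : C) : acar A n -> hom (F X) (UAF T A F n X) :=
  @tin K C T (acar A n) (F X).

Lemma UAF_pureE ns X (a : args (acar A) ns) :
  UAF_pure T F X a = pure tin_UAF X a.
Proof. by elim: ns a => //= n ns IH a; rewrite IH. Qed.

Lemma UAF_inducedE (Th : thetas (UAF T A F)) :
  UAF_induced Th <-> induced tin_UAF Th.
Proof.
by split=> iTh ns h X a; [rewrite -UAF_pureE | rewrite UAF_pureE]; apply: iTh.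
Qed.

End UAF.

(** * The case of tensoring with A alone, via the identity monad *)

Section IdentityMonad.
Variables (K : fieldType) (C : linCat K) (T : copowers C) (A : ainf_algebra K).

Lemma idmul_natural (X Y : C) (f : hom X Y) :
  idm Y ∘ fmor (fcomp (fid C) (fid C)) f = fmor (fid C) f ∘ idm X.
Proof. by rewrite comp1m compm1. Qed.

Lemma idmulA (X : C) : idm X ∘ fmor (fid C) (idm X) = idm X ∘ idm (fid C X).
Proof. by []. Qed.

Definition idmonad : numonad C :=
  @NuMonad K C (fid C)
    (@NatTrans K C C (fcomp (fid C) (fid C)) (fid C) _ idmul_natural) idmulA.

Definition tin_id n (X : C) : acar A n -> hom (idmonad X) (UA T A n X) :=
  @tin K C T (acar A n) X.

Lemma heq_itmul_id k X : heq (itmul idmonad k.+1 X) (idm X).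
Proof.
elim: k => [|k IH]; first exact: Heq.
by rewrite itmulS //= comp1m.
Qed.

Lemma heq_pure_id ns X (a : args (acar A) ns) :
  heq (pure tin_id X a) (UA_pure T X a).
Proof.
elim: ns a => [|n ns IH] a; [exact: Heq | exact: heq_comp (Heq _) (IH _)].
Qed.

(** Iterates of the identity functor reduce to X only for a concrete exponent, so the two notions
    are compared through [heq]. *)
Lemma UA_inducedE (Th : thetas (UA T A)) : UA_induced Th <-> induced tin_id Th.
Proof.
have eqs ns (h : (0 < size ns)%N) X (a : args (acar A) ns) :
    heq (Th ns h X ∘ UA_pure T X a) (Th ns h X ∘ pure tin_id X a) /\
    heq (tin T X (am h a)) (tin_id X (am h a) ∘ itmul idmonad (size ns) X).
  split; first by apply: heq_comp (Heq _) (heq_sym (heq_pure_id X a)).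
  rewrite -[tin T X _]compm1; apply: heq_comp (Heq _) (heq_sym _).
  by case: (size ns) h => // k _; apply: heq_itmul_id.
split=> iTh ns h X a; have [e1 e2] := eqs ns h X a; apply: heq_eq.
  apply: heq_trans (heq_sym e1) _; rewrite iTh; exact: e2.
apply: heq_trans e1 _; rewrite iTh; exact: heq_sym e2.
Qed.

End IdentityMonad.

Theorem proposition7p1 (K : fieldType) (C : linCat K) (hC : grothendieck C)
    (T : copowers C) (A : ainf_algebra K) (F : numonad C)
    (hF : preserves_direct_sums F) :
  (exists Th : thetas (UAF T A F),
     unique (@UAF_induced K C T A F) Th /\ is_ainf_monad Th) /\
  (exists Th : thetas (UA T A),
     unique (@UA_induced K C T A) Th /\ is_ainf_monad Th).
Proof.
split.
- pose t := @tin_UAF K C T A F.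
  have lt n X : linear (t n X) by exact: tin_linear.
  have nt n X Y (f : hom X Y) a :
    fmor (UAF T A F n) f ∘ t n X a = t n Y a ∘ fmor F f by exact: tliftE.
  (* The universal property of the copower of F X, carried through [G]. *)
  have ut G (hG : preserves_direct_sums G) n X Y g lg :=
    @preserves_copower K C T C G (acar A n) (F X) Y g hG lg.
  have [Th iTh] := @exists_induced K C A F (UAF T A F) t lt nt hF ut.
  exists Th; split; last exact: (induced_ainf_monad lt nt hF ut).
  split=> [|Th' iTh']; first exact/UAF_inducedE.
  exact: (induced_unique lt hF ut iTh ((UAF_inducedE Th').1 iTh')).
pose t := @tin_id K C T A.
have lt n X : linear (t n X) by exact: tin_linear.
have nt n (X Y : C) (f : hom X Y) a :
  fmor (UA T A n) f ∘ t n X a = t n Y a ∘ fmor (idmonad C) f by exact: tliftE.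
have hid : preserves_direct_sums (idmonad C) by [].
have ut G (hG : preserves_direct_sums G) n X Y g lg :=
  @preserves_copower K C T C G (acar A n) X Y g hG lg.
have [Th iTh] := @exists_induced K C A (idmonad C) (UA T A) t lt nt hid ut.
exists Th; split; last exact: (induced_ainf_monad lt nt hid ut).
split=> [|Th' iTh']; first exact/UA_inducedE.
exact: (induced_unique lt hid ut iTh ((UA_inducedE Th').1 iTh')).
Qed.
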